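(* Let $\mathcal F$ be a family of functions $f:\{0,1\}^n\to[-1,1]^L$ each of circuit complexity at most $T_{\mathcal F}$, and let $\mathcal R$ be a family of functions $r:\Delta_L\to[-1,1]^L$ each of circuit complexity at most $T_{\mathcal R}$. Define $T:=T_{\mathcal F}+T_{\mathcal R}$. For every distribution $\mu$ on $\{0,1\}^n$, every $g^*:\{0,1\}^n\to\Delta_L$, and every $\varepsilon\in(0,1/2)$, there exists $s:\{0,1\}^n\to\Delta_L$ such that (1) $s$ has circuit complexity $O\!\left(\frac{T\log L}{\varepsilon^2}+L\cdot\mathrm{poly}(1/\varepsilon,\log L)\right)$; (2) $|\langle s-g^*,f\rangle|\le\varepsilon$ for every $f\in\mathcal F$; (3) $\langle s-g^*,r\circ s\rangle\le\varepsilon$ for every $r\in\mathcal R$.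
   Context: $\Delta_L$ denotes the set of probability distributions (probability mass vectors) on $[L]=\{1,\dots,L\}$. For functions $g,h:\{0,1\}^n\to\mathbb R^L$, $\langle g,h\rangle:=\mathbb E_{x\sim\mu}\langle g(x),h(x)\rangle$ where the inner product inside is the standard one on $\mathbb R^L$. *)

(* Defs.v *)
From HB Require Import structures.
From mathcomp Require Import all_boot all_order all_algebra polyXY.
From mathcomp Require Import classical_sets reals exp.

Set Implicit Arguments.
Unset Strict Implicit.
Unset Printing Implicit Defensive.

Import Order.TTheory GRing.Theory Num.Theory.
Local Open Scope classical_set_scope.
Local Open Scope ring_scope.

Definition bits (n : nat) := {ffun 'I_n -> bool}.

(* Delta_L is [distr R 'I_L]; a distribution on {0,1}^n is [distr R (bits n)]. *)
Record distr (R : realType) (T : finType) := Distr {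
  pmf :> {ffun T -> R};
  pmf_ge0 : forall t, 0 <= pmf t;
  pmf_sum1 : \sum_t pmf t = 1 }.

(* The cube [-1, 1]^L *)
Record box (R : realType) (L : nat) := Box {
  box_val :> {ffun 'I_L -> R};
  box_bounded : forall j, -1 <= box_val j <= 1 }.

(* <g, h> = E_{x ~ mu} <g(x), h(x)> *)
Definition inner (R : realType) (n L : nat) (mu : distr R (bits n))
    (g h : bits n -> {ffun 'I_L -> R}) : R :=
  \sum_x mu x * \sum_j g x j * h x j.

(* Circuits whose wires carry real numbers, with unit-cost gates of fan-in at
   most two. Using one such model for all functions gives a meaning to the
   circuit complexity of maps on {0,1}^n and of maps on the continuum Delta_L
   alike, without fixing an encoding of reals by bits. *)
Inductive gate (R : realType) :=
| GConst of R
| GOp of (R -> R -> R) & nat & nat.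

(* A circuit is a straight-line program. Its wires are numbered from 0: first
   the inputs, then the gates in order. Output [j] is read on wire
   [outputs j]. *)
Record circuit (R : realType) (L : nat) := Circuit {
  gates : seq (gate R);
  outputs : 'I_L -> nat }.

(* [w] lists the values of the wires that precede the gate. A reference to a
   wire that does not exist yet reads 0, so no circuit can be cyclic. *)
Definition gate_value (R : realType) (w : seq R) (g : gate R) : R :=
  match g with
  | GConst a => a
  | GOp op i k => op w`_i w`_k
  end.

Definition wires (R : realType) (gs : seq (gate R)) (input : seq R) : seq R :=
  foldl (fun w g => rcons w (gate_value w g)) input gs.

Definition run (R : realType) (L : nat) (c : circuit R L) (input : seq R) :
    {ffun 'I_L -> R} :=
  [ffun j => (wires (gates c) input)`_(outputs c j)].

Definition gate_in (R : realType) (B : set (R -> R -> R)) (g : gate R) : Prop :=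
  match g with
  | GConst _ => True
  | GOp op _ _ => B op
  end.

Definition circuit_over (R : realType) (L : nat) (B : set (R -> R -> R))
    (c : circuit R L) : Prop :=
  forall k, (k < size (gates c))%N -> gate_in B (nth (GConst 0) (gates c) k).

(* The operations that every basis of gates is asked to contain; a basis may
   have more (comparisons, exponential, ...). As usual, x / 0 = 0. *)
Definition arith_ops (R : realType) : set (R -> R -> R) :=
  [set op | [\/ op = (fun x y => x + y), op = (fun x y => x - y),
                op = (fun x y => x * y) | op = (fun x y => x / y)]].

Definition bits_input (R : realType) (n : nat) (x : bits n) : seq R :=
  [seq (x i)%:R | i : 'I_n].

Definition distr_input (R : realType) (L : nat) (p : distr R 'I_L) : seq R :=
  [seq p j | j : 'I_L].

(* [h] has circuit complexity at most [t] over the basis [B], where [input]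
   presents the points of its domain on the input wires. *)
Definition complexity_le (R : realType) (A : Type) (L : nat)
    (B : set (R -> R -> R)) (input : A -> seq R)
    (h : A -> {ffun 'I_L -> R}) (t : R) : Prop :=
  exists c : circuit R L,
    [/\ circuit_over B c, (size (gates c))%:R <= t
      & forall a, run c (input a) = h a].

(* Main.v *)
(** Multiplicative weights. Start from the uniform distribution and, as long as
    some test [h] in [F], [-F] or [Rf \o s] satisfies [<s - g, h> > eps],
    replace [s x j] by [s x j * (1 - eta * h x j)], renormalised, where
    [eta = eps / 4]. The mean cross entropy of [g x] relative to [s x] starts
    at [ln L], is nonnegative, and drops by at least [eps^2 / 8] at each
    replacement, so at most [8 ln L / eps^2] of them occur. A replacement is
    rational in [s] and [h]: with exact real arithmetic it costs one evaluation
    of [h] and [5 L] gates. *)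
Require Import Defs.
From HB Require Import structures.
From mathcomp Require Import all_boot all_order all_algebra polyXY.
From mathcomp Require Import classical_sets reals exp.
From mathcomp Require Import boolp zify ring lra.

Set Implicit Arguments.
Unset Strict Implicit.
Unset Printing Implicit Defensive.

Import Order.TTheory GRing.Theory Num.Theory.
Local Open Scope classical_set_scope.
Local Open Scope ring_scope.

(** * Straight-line programs as sets of computable functions *)

Section Computes.

Variables (R : realType) (A : Type) (B : set (R -> R -> R)).
Variables (input : A -> seq R) (N : nat).
Hypothesis size_input : forall a, size (input a) = N.

Lemma wires_rcons (gs : seq (gate R)) (g : gate R) (w : seq R) :
  wires (rcons gs g) w = rcons (wires gs w) (gate_value (wires gs w) g).
Proof. by rewrite /wires -cats1 foldl_cat. Qed.

Lemma size_wires (gs : seq (gate R)) (w : seq R) :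
  size (wires gs w) = (size w + size gs)%N.
Proof.
elim/last_ind: gs => [|gs g IH]; first by rewrite addn0.
by rewrite wires_rcons !size_rcons IH addnS.
Qed.

Definition gates_over (gs : seq (gate R)) : Prop :=
  forall k, (k < size gs)%N -> gate_in B (nth (GConst 0) gs k).

Lemma gates_over_rcons (gs : seq (gate R)) (g : gate R) :
  gates_over (rcons gs g) <-> gates_over gs /\ gate_in B g.
Proof.
split=> [H|[H Hg] k].
  split=> [k hk|].
    have := H k; rewrite size_rcons nth_rcons hk; apply.
    exact: ltnW.
  by have := H (size gs); rewrite size_rcons nth_rcons ltnn eqxx; apply.
rewrite size_rcons nth_rcons ltnS leq_eqVlt.
by case: ltngtP => // hk _; apply: H.
Qed.

(* Carrying sets of functions, rather than wire numbers, makes gate programs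
   composable without any relocation of wire references. *)
Definition computes (k : nat) (V : set (A -> R)) : Prop :=
  exists gs : seq (gate R),
    [/\ gates_over gs, (size gs <= k)%N
      & forall v, V v -> exists2 i, (i < N + size gs)%N
          & forall a, (wires gs (input a))`_i = v a].

Lemma computes_sub k l (U V : set (A -> R)) :
  (k <= l)%N -> U `<=` V -> computes k V -> computes l U.
Proof.
move=> kl UV [gs [gsB gsk gsV]]; exists gs; split=> //.
  exact: leq_trans gsk kl.
by move=> v /UV/gsV.
Qed.

Lemma computes_input :
  computes 0 [set v | exists2 i, (i < N)%N & v = fun a => (input a)`_i].
Proof.
exists [::]; split=> // v [i iN ->]; exists i => //.
by rewrite addn0.
Qed.

(** Appending a gate renumbers no earlier wire, and the new value sits on wire [N + size gs]. The
    program [gs] is explicit here because [g] refers to its wires by number. *)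
Lemma computes_gate k V (g : gate R) (v : A -> R) gs :
    gates_over gs -> gate_in B g -> (size gs <= k)%N ->
    (forall u, V u -> exists2 i, (i < N + size gs)%N
          & forall a, (wires gs (input a))`_i = u a) ->
    (forall a, gate_value (wires gs (input a)) g = v a) ->
  computes k.+1 (V `|` [set v]).
Proof.
move=> gsB gB gsk gsV gv; exists (rcons gs g); split.
- by apply/gates_over_rcons.
- by rewrite size_rcons.
move=> u [/gsV[i ilt iu]|/= ->].
  exists i; first by rewrite size_rcons addnS ltnS ltnW.
  by move=> a; rewrite wires_rcons nth_rcons size_wires size_input ilt.
exists (N + size gs)%N; first by rewrite size_rcons addnS.
by move=> a; rewrite wires_rcons nth_rcons size_wires size_input ltnn eqxx gv.
Qed.

Lemma computes_const k V (c : R) :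
  computes k V -> computes k.+1 (V `|` [set fun=> c]).
Proof.
by case=> gs [gsB gsk gsV]; apply: (@computes_gate _ _ (GConst c) _ gs).
Qed.

Lemma computes_op k V op (u v : A -> R) :
    B op -> V u -> V v -> computes k V ->
  computes k.+1 (V `|` [set fun a => op (u a) (v a)]).
Proof.
move=> Bop Vu Vv [gs [gsB gsk gsV]].
have [i _ iu] := gsV _ Vu; have [j _ jv] := gsV _ Vv.
apply: (@computes_gate _ _ (GOp op i j) _ gs) => // a.
by rewrite /= iu jv.
Qed.

Lemma computes_ops (I : finType) k V op (u v : I -> A -> R) :
    B op -> (forall i, V (u i)) -> (forall i, V (v i)) -> computes k V ->
  computes (k + #|I|)
    (V `|` [set w | exists i, w = fun a => op (u i a) (v i a)]).
Proof.
move=> Bop Vu Vv kV.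
(* Generalised to lists of indices, as the gates are appended one index at a time. *)
suff H (s : seq I) : computes (k + size s)
    (V `|` [set w | exists2 i, i \in s & w = fun a => op (u i a) (v i a)]).
  rewrite cardE; apply: computes_sub (H _) => //.
  move=> w [Vw|[i ->]]; [by left|right; exists i => //].
  by rewrite mem_enum.
elim: s => [|i s IH].
  by rewrite addn0; apply: computes_sub kV => // w [|[]].
rewrite /= addnS.
have := computes_op Bop (or_introl (Vu i)) (or_introl (Vv i)) IH.
apply: computes_sub => //.
move=> w [Vw|[l]]; first by left; left.
by rewrite inE => /orP[/eqP -> ->|ls ->]; [right|left; right; exists l].
Qed.

(** The zero function is the empty partial sum; each index then costs one addition. *)
Lemma computes_sum (I : finType) k V (u : I -> A -> R) :
    B (fun x y => x + y) -> V (fun=> 0) -> (forall i, V (u i)) ->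
    computes k V ->
  computes (k + #|I|) (V `|` [set fun a => \sum_i u i a]).
Proof.
move=> Badd V0 Vu kV.
suff H (s : seq I) :
    computes (k + size s) (V `|` [set fun a => \sum_(i <- s) u i a]).
  have -> : (fun a => \sum_i u i a) = (fun a => \sum_(i <- enum I) u i a).
    by apply/funext => a; rewrite big_enum.
  by rewrite cardE; apply: H.
elim: s => [|i s IH].
  rewrite addn0; apply: computes_sub kV => // w [//|/= ->].
  rewrite (_ : (fun a => _) = (fun=> 0)) //.
  by apply/funext => a; rewrite big_nil.
rewrite /= addnS.
have := computes_op Badd (or_introl (Vu i)) (or_intror erefl) IH.
apply: computes_sub => //.
move=> w [Vw|/= ->]; first by left; left.
by right; apply/funext => a; rewrite big_cons.
Qed.

(** Inlining: the gates of [gs] are replayed on wires that already carry the entries of [ps], one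
    new gate for each. Since all [ps a] have the same size, the last gate has the same wire number
    for every [a]. *)
Lemma computes_wires k V (gs : seq (gate R)) (ps : A -> seq R) :
    gates_over gs -> (forall i, V (fun a => (ps a)`_i)) ->
    (forall a b, size (ps a) = size (ps b)) ->
    V (fun=> 0) -> computes k V ->
  computes (k + size gs)
    (V `|` [set w | exists i, w = fun a => (wires gs (ps a))`_i]).
Proof.
move=> + Vps szps V0 kV; elim/last_ind: gs => [_|gs g IH].
  rewrite addn0; apply: computes_sub kV => // w [//|[i ->]].
  exact: Vps.
move=> /gates_over_rcons[/IH{}IH gB]; rewrite size_rcons addnS.
set W := V `|` _ in IH.
have {}IH : computes (k + size gs).+1
    (W `|` [set fun a => gate_value (wires gs (ps a)) g]).
  case: g gB => [c _|op i j Bop] /=; first exact: computes_const.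
  by apply: computes_op IH => //; right; [exists i|exists j].
apply: computes_sub IH => // w [Vw|[i ->]]; first by left; left.
(* Only the wire of the new gate carries a new function; the case split also covers an empty [A]. *)
have [[a0 i0]|ine] :=
  pselect (exists a0 : A, i = (size (ps a0) + size gs)%N).
  right; apply/funext => a.
  by rewrite wires_rcons nth_rcons size_wires (szps a a0) i0 ltnn eqxx.
left; right; exists i; apply/funext => a.
rewrite wires_rcons nth_rcons size_wires.
case: ltngtP => // [h|h]; last by case: ine; exists a.
(* Beyond the new wire, both programs read the default 0. *)
by rewrite nth_default // size_wires ltnW.
Qed.

Lemma computes_complexity (L : nat) k V (h : A -> {ffun 'I_L -> R}) (t : R) :
    (forall j, V (fun a => h a j)) -> computes k V -> k%:R <= t ->
  complexity_le B input h t.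
Proof.
move=> Vh [gs [gsB gsk gsV]] kt.
have /fin_all_exists2[o _ oh] : forall j : 'I_L, exists2 i,
    (i < N + size gs)%N & forall a, (wires gs (input a))`_i = h a j.
  by move=> j; apply: gsV.
exists (Circuit gs o); split=> //.
  by apply: le_trans kt; rewrite ler_nat.
by move=> a; apply/ffunP => j; rewrite ffunE /= oh.
Qed.

End Computes.

(** * Running a circuit on values already computed *)

Section CircuitComposition.

Variables (R : realType) (A : Type) (B : set (R -> R -> R)).
Variables (input : A -> seq R) (N : nat).
Hypothesis size_input : forall a, size (input a) = N.

(** Since the presentation of [p a] is already on wires, composing with [p] adds only the gates of
    the circuit for [f]. This serves both [f] (with [p = id]) and [r \o s] (with [p = s]). *)
Lemma computes_comp (A' : Type) (L : nat) (input' : A' -> seq R)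
    (f : A' -> {ffun 'I_L -> R}) (p : A -> A') (t k : nat) V :
    complexity_le B input' f t%:R ->
    (forall a b, size (input' (p a)) = size (input' (p b))) ->
    (forall i, V (fun a => (input' (p a))`_i)) ->
    V (fun=> 0) -> computes B input N k V ->
  computes B input N (k + t)
    (V `|` [set w | exists j, w = fun a => f (p a) j]).
Proof.
case=> c [cB]; rewrite ler_nat => ct cf szp Vp V0 kV.
have := computes_wires size_input cB Vp szp V0 kV.
apply: computes_sub; first by rewrite leq_add2l.
move=> w [Vw|[j ->]]; [by left|right; exists (outputs c j)].
by apply/funext => a; rewrite -cf ffunE.
Qed.

End CircuitComposition.

(** * One multiplicative update and its effect on cross entropy *)

Section MultiplicativeUpdate.

Variables (R : realType) (L : nat).

Lemma pmf_le1 (T : finType) (p : distr R T) t : p t <= 1.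
Proof.
rewrite -(pmf_sum1 p) (bigD1 t) //= lerDl sumr_ge0 // => i _.
exact: pmf_ge0.
Qed.

Lemma distr_ord_gt0 (p : distr R 'I_L) : (0 < L)%N.
Proof.
case: (posnP L) => // L0; have := pmf_sum1 p.
rewrite big1 => [/esym/eqP|j _]; first by rewrite oner_eq0.
by have := leq_trans (ltn_ord j) (eq_leq L0).
Qed.

Lemma update_sum (p : distr R 'I_L) (h : 'I_L -> R) (eta : R) :
  \sum_j p j * (1 - eta * h j) = 1 - eta * \sum_j p j * h j.
Proof.
rewrite -{2}(pmf_sum1 p) mulr_sumr -sumrB; apply: eq_bigr => j _; ring.
Qed.

(** Keeps the factors, and so the normaliser, away from 0, and puts [eta * h j] in the range of
    [ln_oneB_ge]. *)
Lemma oneBmul_ge (eta : R) (h : box R L) j :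
  `|eta| <= 1 / 4 -> 3 / 4 <= 1 - eta * h j.
Proof.
move=> heta; have /andP[h1 h2] := box_bounded h j.
have : `|eta * h j| <= 1 / 4 * 1.
  by rewrite normrM; apply: ler_pM => //; rewrite ler_norml h1.
by rewrite ler_norml => /andP[_ ?]; lra.
Qed.

Lemma update_gt0 (p : distr R 'I_L) (h : box R L) (eta : R) :
  `|eta| <= 1 / 4 -> 0 < \sum_j p j * (1 - eta * h j).
Proof.
move=> heta; apply: (@lt_le_trans _ _ (3 / 4 * \sum_j p j)).
  by rewrite pmf_sum1; lra.
rewrite mulr_sumr; apply: ler_sum => j _.
by rewrite mulrC; apply: ler_wpM2l; [exact: pmf_ge0|exact: oneBmul_ge].
Qed.

Lemma exists_update (p : distr R 'I_L) (h : box R L) (eta : R) :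
    `|eta| <= 1 / 4 ->
  exists q : distr R 'I_L, forall j,
    q j = p j * (1 - eta * h j) / \sum_i p i * (1 - eta * h i).
Proof.
move=> heta; set Z := \sum_i _; have Z0 : 0 < Z by exact: update_gt0.
have qge0 j : 0 <= [ffun j => p j * (1 - eta * h j) / Z] j.
  rewrite ffunE divr_ge0 ?(ltW Z0) ?mulr_ge0 ?pmf_ge0 //.
  by have := oneBmul_ge h j heta; lra.
have qsum : \sum_j [ffun j => p j * (1 - eta * h j) / Z] j = 1.
  under eq_bigr do rewrite ffunE.
  by rewrite -mulr_suml divff // gt_eqF.
by exists (Distr qge0 qsum) => j; rewrite /= ffunE.
Qed.

Lemma ln_le_subr1 (x : R) : 0 < x -> ln x <= x - 1.
Proof. by move=> x0; have := expR_ge1Dx (ln x); rewrite lnK //; lra. Qed.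

(* [ln (1 - y) = - ln (1 + y / (1 - y)) >= - y - y^2 / (1 - y)] *)
Lemma ln_oneB_ge (y : R) : y <= 1 / 2 -> - y - 2 * y ^+ 2 <= ln (1 - y).
Proof.
move=> hy; have y1 : 0 < 1 - y by lra.
have := @ln_le_subr1 (1 - y)^-1; rewrite invr_gt0 => /(_ y1).
rewrite lnV // => H.
have E : (1 - y)^-1 - 1 = y + y ^+ 2 / (1 - y) by field; lra.
have : y ^+ 2 / (1 - y) <= 2 * y ^+ 2.
  rewrite ler_pdivrMr // -mulrA mulrCA ler_peMr ?sqr_ge0 //; lra.
by lra.
Qed.

(* The cross entropy of [g] relative to [q]; it differs from the Kullback-
   Leibler divergence by the entropy of [g], which no update changes. *)
Definition xentropy (g q : distr R 'I_L) : R := - \sum_j g j * ln (q j).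

Lemma xentropy_ge0 (g q : distr R 'I_L) : 0 <= xentropy g q.
Proof.
rewrite /xentropy oppr_ge0 sumr_le0 // => j _.
by rewrite mulr_ge0_le0 ?pmf_ge0 // ln_le0 // pmf_le1.
Qed.

(** Expand [ln (q j)] as [ln (p j) + ln (1 - eta * h j) - ln Z], bound the middle term below to
    second order and [ln Z] above to first order, then average against [g]. The linear terms combine
    into the correlation of [p - g] with [h]. *)
Lemma xentropy_update (g p q : distr R 'I_L) (h : box R L) (eta : R) :
    `|eta| <= 1 / 4 -> (forall j, 0 < p j) ->
    (forall j, q j = p j * (1 - eta * h j) / \sum_i p i * (1 - eta * h i)) ->
  xentropy g q <=
    xentropy g p - eta * (\sum_j (p j - g j) * h j) + 2 * eta ^+ 2.
Proof.
move=> heta p0 qE; set Z := \sum_i _ in qE.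
have Z0 : 0 < Z by exact: update_gt0.
have lnZ : ln Z <= - eta * \sum_j p j * h j.
  by have := ln_le_subr1 Z0; rewrite {2}/Z update_sum; lra.
have term j : g j * (ln (p j) - eta * h j - 2 * eta ^+ 2 - ln Z)
    <= g j * ln (q j).
  have pos : 0 < 1 - eta * h j by have := oneBmul_ge h j heta; lra.
  apply: ler_wpM2l; first exact: pmf_ge0.
  rewrite qE ln_div ?posrE ?mulr_gt0 // lnM ?posrE //.
  have /andP[h1 h2] := box_bounded h j.
  have hsq : (eta * h j) ^+ 2 <= eta ^+ 2.
    by rewrite exprMn ler_piMr ?sqr_ge0 // expr2; nra.
  have : - (eta * h j) - 2 * (eta * h j) ^+ 2 <= ln (1 - eta * h j).
    by apply: ln_oneB_ge; have := oneBmul_ge h j heta; lra.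
  by lra.
rewrite /xentropy.
have := ler_sum (index_enum 'I_L) (P := xpredT) (fun j _ => term j).
rewrite (_ : \sum_j _ = \sum_j g j * ln (p j) - eta * (\sum_j g j * h j)
    - (2 * eta ^+ 2 + ln Z) * \sum_j g j); last first.
  by rewrite !mulr_sumr -!sumrB; apply: eq_bigr => j _; ring.
rewrite pmf_sum1 (_ : \sum_j (p j - g j) * h j =
    \sum_j p j * h j - \sum_j g j * h j); first lra.
by rewrite -sumrB; apply: eq_bigr => j _; ring.
Qed.

End MultiplicativeUpdate.

(** * Gate cost and potential drop of one round *)

Section Round.

Variables (R : realType) (B : set (R -> R -> R)) (n L : nat).
Variables (mu : distr R (bits n)) (g : bits n -> distr R 'I_L).
Hypothesis arithB : @arith_ops R `<=` B.

Lemma size_bits_input (x : bits n) : size (bits_input R x) = n.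
Proof. by rewrite size_map size_enum_ord. Qed.

Lemma size_distr_input (p : distr R 'I_L) : size (distr_input p) = L.
Proof. by rewrite size_map size_enum_ord. Qed.

Lemma nth_distr_input (p : distr R 'I_L) (j : 'I_L) : (distr_input p)`_j = p j.
Proof. by rewrite (nth_map j) ?size_enum_ord // nth_ord_enum. Qed.

(** Five passes of [L] gates: multiply by [eta], subtract from 1, multiply by the weights, sum,
    divide by the sum. The sum is computed once and shared by all divisions. *)
Lemma computes_update k V (s s' : bits n -> distr R 'I_L) (eta : R)
    (h : bits n -> box R L) :
    V (fun=> 0) -> V (fun=> 1) -> V (fun=> eta) ->
    (forall j, V (fun x => s x j)) -> (forall j, V (fun x => h x j)) ->
    (forall x j, s' x j =
      s x j * (1 - eta * h x j) / \sum_i s x i * (1 - eta * h x i)) ->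
    computes B (@bits_input R n) n k V ->
  computes B (@bits_input R n) n (k + 5 * L)
    (V `|` [set w | exists j, w = fun x => s' x j]).
Proof.
move=> V0 V1 Ve Vs Vh s'E kV.
have Badd : B (fun x y => x + y) by apply: arithB; constructor 1.
have Bsub : B (fun x y => x - y) by apply: arithB; constructor 2.
have Bmul : B (fun x y => x * y) by apply: arithB; constructor 3.
have Bdiv : B (fun x y => x / y) by apply: arithB; constructor 4.
have := computes_ops size_bits_input Bmul (fun=> Ve) Vh kV => c1.
set V1' := (X in computes _ _ _ _ X) in c1.
have := computes_ops (V := V1') (u := fun _ : 'I_L => fun=> 1)
  (v := fun j x => eta * h x j) size_bits_input Bsub
  (fun=> or_introl V1) (fun j => or_intror (ex_intro _ j erefl)) c1 => c2.
set V2 := (X in computes _ _ _ _ X) in c2.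
have := computes_ops (V := V2)
  (u := fun j x => s x j) (v := fun j x => 1 - eta * h x j)
  size_bits_input Bmul
  (fun j => or_introl (or_introl (Vs j)))
  (fun j => or_intror (ex_intro _ j erefl)) c2 => c3.
set V3 := (X in computes _ _ _ _ X) in c3.
have := computes_sum (V := V3) (u := fun j x => s x j * (1 - eta * h x j))
  size_bits_input Badd (or_introl (or_introl (or_introl V0)))
  (fun j => or_intror (ex_intro _ j erefl)) c3 => c4.
set V4 := (X in computes _ _ _ _ X) in c4.
have := computes_ops (V := V4)
  (u := fun j x => s x j * (1 - eta * h x j))
  (v := fun _ x => \sum_i s x i * (1 - eta * h x i)) size_bits_input Bdiv
  (fun j => or_introl (or_intror (ex_intro _ j erefl)))
  (fun=> or_intror erefl) c4.
rewrite !card_ord; apply: computes_sub; first by rewrite !mulSn; lia.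
move=> w [Vw|[j ->]]; first by do 5 left.
by right; exists j; apply/funext => x; rewrite s'E.
Qed.

Definition potential (s : bits n -> distr R 'I_L) : R :=
  \sum_x mu x * xentropy (g x) (s x).

Lemma potential_ge0 s : 0 <= potential s.
Proof.
by apply: sumr_ge0 => x _; rewrite mulr_ge0 ?pmf_ge0 ?xentropy_ge0.
Qed.

(** Averages [xentropy_update] over [mu]. Positivity is passed on so that the next round can take
    logarithms again. *)
Lemma potential_update (s : bits n -> distr R 'I_L) (eta : R)
    (h : bits n -> box R L) :
    `|eta| <= 1 / 4 -> (forall x j, 0 < s x j) ->
  exists s' : bits n -> distr R 'I_L,
  [/\ forall x j, s' x j =
        s x j * (1 - eta * h x j) / \sum_i s x i * (1 - eta * h x i),
      forall x j, 0 < s' x j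
    & potential s' <= potential s
        - eta * inner mu (fun x => pmf (s x) - pmf (g x))
                         (fun x => box_val (h x))
        + 2 * eta ^+ 2].
Proof.
move=> heta s0.
have /choice[s' s'E] := fun x => exists_update (s x) (h x) heta.
exists s'; split=> // [x j|].
  rewrite s'E divr_gt0 ?update_gt0 // mulr_gt0 //.
  by have := oneBmul_ge (h x) j heta; lra.
pose ip x := \sum_j (pmf (s x) - pmf (g x)) j * h x j.
have -> : potential s - eta * inner mu (fun x => pmf (s x) - pmf (g x))
                (fun x => box_val (h x)) + 2 * eta ^+ 2 =
    \sum_x mu x * (xentropy (g x) (s x) - eta * ip x + 2 * eta ^+ 2).
  transitivity (potential s - eta * (\sum_x mu x * ip x)
      + 2 * eta ^+ 2 * \sum_x mu x); first by rewrite pmf_sum1 mulr1.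
  rewrite !mulr_sumr -sumrB -big_split /=; apply: eq_bigr => x _; ring.
apply: ler_sum => x _; apply: ler_wpM2l; first exact: pmf_ge0.
rewrite (_ : ip x = \sum_j (s x j - g x j) * h x j).
  exact: xentropy_update.
by apply: eq_bigr => j _; rewrite !ffunE.
Qed.

Lemma exists_uniform : (0 < L)%N ->
  exists p : distr R 'I_L, forall j, p j = L%:R^-1.
Proof.
move=> L0.
have u0 (j : 'I_L) : 0 <= [ffun=> L%:R^-1 : R] j by rewrite ffunE invr_ge0.
have u1 : \sum_(j < L) [ffun=> L%:R^-1 : R] j = 1.
  under eq_bigr do rewrite ffunE.
  by rewrite sumr_const card_ord -[LHS]mulr_natr mulVf // pnatr_eq0 -lt0n.
by exists (Distr u0 u1) => j; rewrite /= ffunE.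
Qed.

Lemma potential_uniform (s : bits n -> distr R 'I_L) :
  (forall x j, s x j = L%:R^-1) -> potential s = ln L%:R.
Proof.
move=> sE; have L0 := distr_ord_gt0 (g [ffun=> false]).
transitivity (\sum_x mu x * ln L%:R).
  apply: eq_bigr => x _; congr (_ * _); rewrite /xentropy.
  under eq_bigr do rewrite sE.
  by rewrite -mulr_suml pmf_sum1 mul1r lnV ?opprK // posrE ltr0n.
by rewrite -mulr_suml pmf_sum1 mul1r.
Qed.

(** What a round needs on wires: 0 starts sums, 1 and a signed step size form the factors, the bits
    feed tests in [F], and [s] feeds both the update and tests in [Rf]. *)
Definition carried (eta : R) (s : bits n -> distr R 'I_L) :
    set (bits n -> R) :=
  [set v | [\/ exists2 c, c \in [:: 0; 1; eta; - eta] & v = fun=> c,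
               exists i, v = fun x => (bits_input R x)`_i
             | exists j, v = fun x => s x j]].

Lemma computes_uniform eta (s : bits n -> distr R 'I_L) :
    (forall x j, s x j = L%:R^-1) ->
  computes B (@bits_input R n) n 5 (carried eta s).
Proof.
move=> sE; have := computes_input B (@bits_input R n) n.
move=> /(computes_const size_bits_input 0) /(computes_const size_bits_input 1).
move=> /(computes_const size_bits_input eta).
move=> /(computes_const size_bits_input (- eta)).
move=> /(computes_const size_bits_input (L%:R^-1)).
apply: computes_sub => // v [[c]|[i ->]|[j ->]].
- rewrite !inE => /or4P[] /eqP-> ->.
  + by do 4 left; right.
  + by do 3 left; right.
  + by do 2 left; right.
  + by left; right.
(* An index past the input reads 0, which the constant wire 0 supplies. *)
- case: (ltnP i n) => hi; first by do 5 left; exists i.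
  do 4 left; right; apply/funext => x.
  by rewrite nth_default // size_bits_input.
- by right; apply/funext => x; rewrite sE.
Qed.

End Round.

(** * Iteration, termination and total cost *)

Theorem theorem3p1 (R : realType) (B : set (R -> R -> R))
    (arithB : @arith_ops R `<=` B) :
  exists (C : R) (P : {poly {poly R}}),
  forall (n L TF TR : nat)
    (F : set (bits n -> box R L)) (Rf : set (distr R 'I_L -> box R L)),
  (forall f, F f ->
     complexity_le B (@bits_input R n) (fun x => box_val (f x)) TF%:R) ->
  (forall r, Rf r ->
     complexity_le B (@distr_input R L) (fun p => box_val (r p)) TR%:R) ->
  let T := (TF + TR)%N in
  forall (mu : distr R (bits n)) (g : bits n -> distr R 'I_L) (eps : R),
  0 < eps < 1 / 2 ->
  exists s : bits n -> distr R 'I_L,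
  [/\ complexity_le B (@bits_input R n) (fun x => pmf (s x))
        (C * (T%:R * ln L%:R / eps ^+ 2 + L%:R * P.[1 / eps, ln L%:R])),
      forall f, F f ->
        `| inner mu (fun x => pmf (s x) - pmf (g x))
                    (fun x => box_val (f x)) | <= eps
    & forall r, Rf r ->
        inner mu (fun x => pmf (s x) - pmf (g x))
                 (fun x => box_val (r (s x))) <= eps].
Proof.
(* As a polynomial in [X = 1 / eps] and [Y = ln L], this is [1 + X^2 Y]. The constant 40 is 8, from
   the number of rounds, times 5, from the gates per coordinate. *)
pose P : {poly {poly R}} := 1 + 'X ^+ 2 * ('X)%:P.
exists 40, P.
move=> n L TF TR F Rf cF cR T mu g eps /andP[e0 e1].
(* The value of [g] at any one point is a distribution, which excludes [L = 0]. *)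
have L0 := distr_ord_gt0 (g [ffun=> false]).
(* This maximises the guaranteed drop [eta * eps - 2 * eta ^+ 2], giving [eps ^+ 2 / 8]. *)
pose eta := eps / 4.
have [eta0 eta1 neta1] : [/\ 0 < eta, `|eta| <= 1 / 4 & `|- eta| <= 1 / 4].
  by rewrite normrN ger0_norm /eta; [split; lra|lra].
pose reach (K : nat) (s : bits n -> distr R 'I_L) := [/\ forall x j, 0 < s x j,
  potential mu g s <= ln L%:R - K%:R * (eps ^+ 2 / 8)
  & computes B (@bits_input R n) n (5 + K * (T + 5 * L)) (carried eta s)].
pose excess (s : bits n -> distr R 'I_L) (h : bits n -> box R L) :=
  inner mu (fun x => pmf (s x) - pmf (g x))
    (fun x => box_val (h x) : {ffun 'I_L -> R}).
(* The ratio [c / eta] is a sign, so one statement treats violations by [h] and by [-h] without a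
   circuit for [-h]. *)
have step K s h c t : reach K s -> (t <= T)%N -> c \in [:: eta; - eta] ->
    eps < (c / eta) * excess s h ->
    (forall k V, computes B (@bits_input R n) n k V ->
      carried eta s `<=` V -> computes B (@bits_input R n) n (k + t)
        (V `|` [set w | exists j, w = fun x => h x j])) ->
  exists s', reach K.+1 s'.
  move=> [s0 sP sV] tT cE ce ch.
  have [c1 c2] : `|c| <= 1 / 4 /\ c ^+ 2 = eta ^+ 2.
    by move: cE; rewrite !inE => /orP[]/eqP->; rewrite ?sqrrN.
  have [s' [s'E s'0 s'P]] := potential_update mu g h c1 s0.
  exists s'; split=> //.
    apply: le_trans s'P _; rewrite -/(excess s h).
    have : eta * eps <= c * excess s h.
      have -> : c * excess s h = eta * (c / eta * excess s h).
        by field; rewrite gt_eqF.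
      by rewrite ler_pM2l // ltW.
    rewrite c2 /eta -[K.+1%:R]natr1; lra.
  have cst d : d \in [:: 0; 1; eta; - eta] -> carried eta s (fun=> d).
    by move=> hd; constructor 1; exists d.
  have {}ch := ch _ _ sV (fun _ => id).
  set V := _ `|` _ in ch.
  have sub : carried eta s `<=` V by left.
  have cc : c \in [:: 0; 1; eta; - eta].
    by move: cE; rewrite !inE => /orP[]->; rewrite ?orbT.
  have c0 : 0 \in [:: 0; 1; eta; - eta] by rewrite inE eqxx.
  have c1' : 1 \in [:: 0; 1; eta; - eta] by rewrite !inE eqxx orbT.
  have := computes_update arithB (sub _ (cst 0 c0)) (sub _ (cst 1 c1'))
    (sub _ (cst c cc)) (fun j => sub _ (Or33 _ _ (ex_intro _ j erefl)))
    (fun j => or_intror (ex_intro _ j erefl)) s'E ch.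
  apply: computes_sub; first by rewrite mulSn; lia.
  move=> v [[d hd ->]|[i ->]|[j ->]]; last by right; exists j.
    by left; apply: sub; apply: cst.
  by left; apply: sub; constructor 2; exists i.
pose good s := (forall f, F f -> `|excess s f| <= eps) /\
  (forall r, Rf r -> excess s (r \o s) <= eps).
(* Any violated test would itself drive a further round. *)
have stuck_good K s : reach K s -> ~ (exists s', reach K.+1 s') -> good s.
  move=> rs stuck; split=> [f Ff|r Rr]; rewrite leNgt; apply/negP => lt_eps;
    apply: stuck.
    have comp_f k V : computes B (@bits_input R n) n k V ->
        carried eta s `<=` V -> computes B (@bits_input R n) n (k + TF)
          (V `|` [set w | exists j, w = fun x => f x j]).
      move=> kV sV.
      apply: (computes_comp (@size_bits_input R n) (p := id) (cF _ Ff)) => //.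
      + by move=> x y; rewrite !size_bits_input.
      + by move=> i; apply: sV; constructor 2; exists i.
      + by apply: sV; constructor 1; exists 0; rewrite ?inE ?eqxx.
    have TFT : (TF <= T)%N by rewrite leq_addr.
    move: lt_eps; rewrite ltr_normr => /orP[] lt_eps.
      apply: (step _ _ f eta TF rs) => //; first by rewrite inE eqxx.
      by rewrite divff ?mul1r // gt_eqF.
    apply: (step _ _ f (- eta) TF rs) => //; first by rewrite !inE eqxx orbT.
    by rewrite mulNr divff ?mulN1r // gt_eqF.
  apply: (step _ _ (r \o s) eta TR rs) => //.
  - by rewrite leq_addl.
  - by rewrite inE eqxx.
  - by rewrite divff ?mul1r // gt_eqF.
  move=> k V kV sV.
  have V0 : V (fun=> 0).
    by apply: sV; constructor 1; exists 0; rewrite ?inE ?eqxx.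
  apply: (computes_comp (@size_bits_input R n) (p := s) (cR _ Rr)) => //.
    by move=> x y; rewrite !size_distr_input.
  move=> i; case: (ltnP i L) => hi.
    apply: sV; constructor 3; exists (Ordinal hi); apply/funext => x.
    by rewrite -nth_distr_input.
  rewrite (_ : (fun x => _) = fun=> 0) //; apply/funext => x.
  by rewrite nth_default // size_distr_input.
(* The potential cannot fall below 0. *)
have reach_bound K s : reach K s -> K%:R <= 8 * (ln L%:R / eps ^+ 2).
  case=> _ sP _; have := le_trans (potential_ge0 mu g s) sP.
  by rewrite [8 * _]mulrA ler_pdivlMr ?exprn_gt0 //; lra.
(* Otherwise every reached [s] admits another round, so every [K] is reachable from the uniform
   start, against [reach_bound] at an Archimedean bound. *)
have [K [s [rs [gF gR]]]] : exists K s, reach K s /\ good s.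
  apply: contrapT => nog.
  have all_reach K : exists s, reach K s.
    elim: K => [|K [s rs]].
      have [u uE] := exists_uniform R L0.
      exists (fun=> u); split=> [x j||].
      - by rewrite uE invr_gt0 ltr0n.
      - by rewrite mul0r subr0 (potential_uniform mu g).
      - exact: computes_uniform.
    apply: contrapT => stuck; apply: nog; exists K, s; split=> //.
    exact: stuck_good rs stuck.
  have [s /reach_bound] := all_reach (Num.bound (8 * (ln L%:R / eps ^+ 2))).
  rewrite leNgt archi_boundP // mulr_ge0 // divr_ge0 ?sqr_ge0 // ln_ge0 //.
  by rewrite ler1n.
exists s; split=> //.
have Kle := reach_bound _ _ rs; case: rs => _ _ sV.
apply: (computes_complexity (L := L) _ sV).
  by move=> j; constructor 3; exists j.
set y := ln L%:R / eps ^+ 2 in Kle.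
have -> : P.[1 / eps, ln L%:R] = 1 + y.
  rewrite /P !hornerE /y; field; by rewrite gt_eqF.
rewrite -mulrA -/y (natrD _ 5) (natrM _ K) (natrD _ T) (natrM _ 5).
have L1 : 1 <= L%:R :> R by rewrite ler1n.
have T0 : 0 <= T%:R :> R by [].
(* Here [1 <= L] lets the initial 5 gates be absorbed into [40 * L]. *)
apply: (@le_trans _ _ (5 + 8 * y * (T%:R + 5 * L%:R))); last first.
  have y0 : 0 <= y by rewrite divr_ge0 ?sqr_ge0 // ln_ge0.
  have := mulr_ge0 T0 y0; lra.
by rewrite lerD2l ler_wpM2r //; lra.
Qed.
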